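(* Let $H$ be a connected undirected graph, and let $H_0$ be the digraph obtained from $H$ by replacing every edge $\{i,j\}\in E(H)$ with the two directed edges $ij$ and $ji$. Let $\varepsilon=\{Q_1,\ldots,Q_r\}$ be any biclique partition of $H_0$. Then for every $u\in V(H)$ the number of spanning trees of $H$ is equal to $\kappa_u(H_0)$, and for every $i=1,\ldots,r$, $$\kappa_u(H_0)=\frac{\prod_{v\in V(H)}d_v}{\prod_{j=1}^r|Q_j^{(2)}|}\cdot\frac{t_{Q_i}(\Theta(\varepsilon))}{|Q_i^{(1)}|},$$ where $d_v$ is the degree of vertex $v$ in $H$ and $\Theta(\varepsilon)$ is the weighted biclique digraph of $\varepsilon$ defined in the context.
   Context: Graphs and digraphs are finite; edges of a digraph are ordered pairs, $ij$ denoting a directed edge from tail $i$ to head $j$. An oriented spanning tree of a (weighted) digraph $G$ with root $u$ is a subtree containing all vertices of $G$ in which $u$ has outdegree $0$ and every other vertex has outdegree $1$ (all edges point towards the root). $\mathbb{T}_u(G)$ is the set of oriented spanning trees of $G$ with root $u$, $\kappa_u(G)=|\mathbb{T}_u(G)|$, and for a weighted digraph with edge weights $w_e(G)$, $t_u(G)=\sum_{T\in\mathbb{T}_u(G)}\prod_{e\in E(T)}w_e(G)$. A biclique is a bipartite digraph $Q$ whose vertices are partitioned into two (nonempty, disjoint) parts $Q^{(1)},Q^{(2)}$ with $E(Q)=\{ij:i\in Q^{(1)},j\in Q^{(2)}\}$. A biclique partition of a digraph $G$ is a set $\varepsilon=\{Q_1,\ldots,Q_r\}$ of bicliques in $G$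 (subdigraphs of $G$) such that each edge of $G$ belongs to exactly one biclique of $\varepsilon$. For a biclique partition $\varepsilon$ of $H_0$, $\Theta(\varepsilon)$ is the weighted digraph with vertex set $\{Q_1,\ldots,Q_r\}$ and edge set $\{Q_iQ_j:Q_i^{(2)}\cap Q_j^{(1)}\neq\emptyset\}$, where the edge $Q_iQ_j$ has weight $$w_{Q_iQ_j}(\Theta(\varepsilon))=|Q_j^{(2)}|\sum_{u\in Q_i^{(2)}\cap Q_j^{(1)}}\frac{1}{d_u},$$ with $d_u$ the degree of $u$ in $H$ (equal to the outdegree of $u$ in $H_0$). *)

(* Defs.v *)
From mathcomp Require Import all_boot all_order all_algebra.

Set Implicit Arguments.
Unset Strict Implicit.
Unset Printing Implicit Defensive.

Import GRing.Theory Num.Theory.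

Local Open Scope ring_scope.

(* A simple undirected graph on V is a symmetric irreflexive relation on V;
   a digraph on V is given by its set of arcs A : {set V * V}, where (i, j) is
   the arc with tail i and head j. *)

Section Graphs.

Variable V : finType.
Implicit Types (e : rel V) (A : {set V * V}) (u v : V).

Definition connected e : bool := [forall x, forall y, connect e x y].

(* A cycle visits pairwise distinct vertices, so its length is at most #|V|;
   x - y - x is not a cycle of a simple graph. *)
Definition acyclic e : bool :=
  [forall n : 'I_#|V|.+1, forall c : n.-tuple V, (2 < n)%N ==> ~~ ucycleb e c].

Definition is_tree e : bool := connected e && acyclic e.

Definition edges e : {set {set V}} := [set [set p.1; p.2] | p : V * V & e p.1 p.2].

Definition edge_rel (T : {set {set V}}) : rel V := [rel x y | [set x; y] \in T].

Definition spanning_trees e : {set {set {set V}}} :=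
  [set T : {set {set V}} | (T \subset edges e) && is_tree (edge_rel T)].

Definition degree e v : nat := #|[set y | e v y]|.

(* The digraph H_0 of the undirected graph H: since e is symmetric, each edge
   {i, j} contributes the two arcs (i, j) and (j, i). *)
Definition bidirected e : {set V * V} := [set p | e p.1 p.2].

Definition outdegree A v : nat := #|[set p in A | p.1 == v]|.

Definition underlying A : rel V := [rel x y | ((x, y) \in A) || ((y, x) \in A)].

(* Loops and opposite arcs are invisible to is_tree (underlying T), but the
   outdegree conditions exclude them: T has #|V| - 1 arcs, which is the least
   number of non-loop edges connecting V. *)
Definition oriented_spanning_trees A u : {set {set V * V}} :=
  [set T : {set V * V} | [&& T \subset A, is_tree (underlying T),
     outdegree T u == 0%N & [forall v, (v != u) ==> (outdegree T v == 1%N)]]].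

Definition kappa A u : nat := #|oriented_spanning_trees A u|.

Definition tree_weight A (w : V -> V -> rat) u : rat :=
  \sum_(T in oriented_spanning_trees A u) \prod_(p in T) w p.1 p.2.

(* A biclique Q is given by its pair of parts (Q^(1), Q^(2)). *)
Definition biclique_arcs (Q : {set V} * {set V}) : {set V * V} := setX Q.1 Q.2.

Definition biclique_in A (Q : {set V} * {set V}) : bool :=
  [&& Q.1 != set0, Q.2 != set0, [disjoint Q.1 & Q.2] & biclique_arcs Q \subset A].

(* The bicliques Q i are automatically pairwise distinct: each one has an arc,
   and no arc of A lies in two of them.  So a family describes a set. *)
Definition biclique_partition A (r : nat) (Q : 'I_r -> {set V} * {set V}) : Prop :=
  (forall i, biclique_in A (Q i)) /\
  (forall p, p \in A -> exists! i, p \in biclique_arcs (Q i)).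

(* The weighted biclique digraph, on the index set of the partition. *)
Definition Theta_arcs (r : nat) (Q : 'I_r -> {set V} * {set V}) :
    {set 'I_r * 'I_r} :=
  [set p | (Q p.1).2 :&: (Q p.2).1 != set0].

Definition Theta_weight e (r : nat) (Q : 'I_r -> {set V} * {set V})
    (i j : 'I_r) : rat :=
  #|(Q j).2|%:R * \sum_(u in (Q i).2 :&: (Q j).1) (degree e u)%:R^-1.

End Graphs.

(* Main.v *)
(* Over V, the Laplacian of H_0 is D - B C, where B and C are the incidence
   matrices of the tails and heads of the bicliques; over the bicliques, the
   Laplacian of Theta is (1 - C D^-1 B) q, where q = diag |Q_j^(2)|.  Let M be
   the identity with its i-th diagonal entry replaced by 0.  Then
     det (D - B M C) = det D * det (1 - M C D^-1 B).
   On the left, deleting Q_i adds the rank one matrix (col i B) (row i C) to the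
   Laplacian of H_0; since its rows and columns sum to 0, the determinant is
   |Q_i^(1)| |Q_i^(2)| kappa_u.  On the right, multiplication by q gives the
   Laplacian of Theta with row i replaced by |Q_i^(2)| delta_i, whose determinant
   is |Q_i^(2)| t_(Q_i) by the matrix-tree theorem.  Trees rooted at u are
   handled as functions sending each vertex to its parent and fixing u. *)

Require Import Defs.
From mathcomp Require Import all_boot all_order perm all_algebra.

Import GRing.Theory Num.Theory.

Local Open Scope ring_scope.

(** * Rooted trees as parent functions *)

Section ParentFunctions.

Set Implicit Arguments.
Unset Strict Implicit.

Variable V : finType.
Implicit Types (e R : rel V) (A : {set V * V}) (u v x y : V) (f g : {ffun V -> V}).

(** [fconnect] follows the iterates of [f], so every orbit ends at the fixed point [u]. The loop at
    [u] stands for outdegree 0 and is left out of [parent_arcs] and [parent_edges]. *)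
Definition rooted f u : bool := (f u == u) && [forall v, fconnect f v u].

Definition parent_functions A u : {set {ffun V -> V}} :=
  [set f | rooted f u && [forall v, (v != u) ==> ((v, f v) \in A)]].

Definition parent_arcs u f : {set V * V} :=
  [set p | (p.1 != u) && (f p.1 == p.2)].

Definition parent_edges u f : {set {set V}} :=
  [set [set v; f v] | v in predC1 u].

Lemma rooted_root {f u} : rooted f u -> f u = u.
Proof. by case/andP => /eqP. Qed.

Lemma rooted_connect {f u} : rooted f u -> forall v, fconnect f v u.
Proof. by case/andP => _ /forallP. Qed.

Lemma rooted_ind f u (P : V -> Prop) : rooted f u -> P u ->
  (forall v, v != u -> P (f v) -> P v) -> forall v, P v.
Proof.
move=> rf Pu Pf v; have := iter_findex (rooted_connect rf v).
move: (findex f v u) => k; elim: k v => [|k IHk] v; first by move=> /= ->.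
rewrite iterSr => fkv; have [->//|vNu] := eqVneq v u.
exact/Pf/IHk.
Qed.

(** The least number of iterations leading to [u] serves as depth. *)
Lemma parent_depth f u : rooted f u ->
  exists d : V -> nat, forall v, v != u -> d v = (d (f v)).+1.
Proof.
move=> rf.
have ex v : exists k, iter k f v == u.
  by exists (findex f v u); rewrite iter_findex ?(rooted_connect rf).
exists (fun v => ex_minn (ex v)) => v vNu.
case: ex_minnP => -[|m] /eqP hm minm; first by rewrite -hm eqxx in vNu.
case: ex_minnP => k /eqP hk mink; congr _.+1; apply/eqP; rewrite eqn_leq.
have := minm k.+1; rewrite iterSr hk eqxx ltnS => -> //.
by apply: mink; rewrite -iterSr hm.
Qed.

Lemma underlying_sym A : symmetric (underlying A).
Proof. by move=> x y; rewrite /underlying /= orbC. Qed.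

Lemma underlying_parent u f x y : underlying (parent_arcs u f) x y =
  (x != u) && (f x == y) || (y != u) && (f y == x).
Proof. by rewrite /underlying /= !inE. Qed.

Lemma connected_parent f u : rooted f u -> connected (underlying (parent_arcs u f)).
Proof.
move=> rf; set R := underlying _.
have Rsym : connect_sym R by apply: sym_connect_sym; apply: underlying_sym.
have Ru : forall v, connect R v u.
  apply: (rooted_ind rf) => // v vNu; apply: connect_trans.
  by apply: connect1; rewrite /R underlying_parent vNu eqxx.
apply/forallP => x; apply/forallP => y.
by apply: connect_trans (Ru x) _; rewrite Rsym.
Qed.

(* Both neighbours of the deepest vertex of a cycle must be its parent. *)
Lemma acyclic_parent f u : rooted f u -> acyclic (underlying (parent_arcs u f)).
Proof.
move=> rf; set R := underlying _; have [d dP] := parent_depth rf.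
apply/forallP => n; apply/forallP => c; apply/implyP => n_gt2; apply/negP.
case/andP => cyc unc.
have c0 : (0 < size c)%N by rewrite size_tuple (ltn_trans _ n_gt2).
have [z zc] : exists z, z \in tval c.
  by case: (tval c) c0 => // z s _; exists z; rewrite mem_head.
case: (@arg_maxnP _ z (mem c) d zc) => m mc mmax.
have par x : x \in tval c -> R m x -> f m = x.
  move=> xc; rewrite /R underlying_parent => /orP [/andP [_ /eqP //]|].
  case/andP => xNu /eqP fx; have := mmax x xc.
  by rewrite (dP _ xNu) fx /= ltnn.
have fnext : f m = next c m.
  by apply: par; [rewrite mem_next | apply: next_cycle].
have fprev : f m = prev c m.
  apply: par; first by rewrite mem_prev.
  by rewrite /R underlying_sym; apply: prev_cycle.
(* Two steps along the cycle return to [m], which a duplicate-free cycle of length at least 3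
   forbids. *)
have : next c (next c m) = m by rewrite -fnext fprev next_prev.
have [i s' def] := rot_to mc.
rewrite -!(next_rot i unc) def.
have := unc; rewrite -(rot_uniq i) def /=.
have := congr1 size def; rewrite size_rot size_tuple => sn.
case: s' def sn => [|a [|b s]] def sn; rewrite ?sn // in n_gt2 *.
rewrite /= !inE !negb_or eqxx => /andP [/and3P [ma mb _] _].
by rewrite [a == m]eq_sym (negPf ma) eqxx => bm; rewrite bm eqxx in mb.
Qed.

Lemma is_tree_parent f u : rooted f u -> is_tree (underlying (parent_arcs u f)).
Proof. by move=> rf; rewrite /is_tree connected_parent ?acyclic_parent. Qed.

Lemma eq_is_tree R R' : R =2 R' -> is_tree R = is_tree R'.
Proof.
move=> eqR; congr andb.
  by apply: eq_forallb => x; apply: eq_forallb => y; apply: eq_connect.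
apply: eq_forallb => n; apply: eq_forallb => c; congr (_ ==> ~~ (_ && _)).
exact: eq_cycle.
Qed.

Lemma outdegree_parent f u v :
  outdegree (parent_arcs u f) v = (v != u).
Proof.
rewrite /outdegree; have [->|vNu] := eqVneq v u.
  by apply: eq_card0 => -[x y]; rewrite !inE /=; case: (x == u); rewrite ?andbF.
apply/eqP/cards1P; exists (v, f v); apply/setP => -[x y].
rewrite !inE xpair_eqE /= andbC; have [->|//] := eqVneq x v.
by rewrite vNu /= eq_sym.
Qed.

Lemma parent_arcs_inj A u : {in parent_functions A u &, injective (parent_arcs u)}.
Proof.
move=> f g; rewrite !inE => /andP [rf _] /andP [rg _] /setP eqfg.
apply/ffunP => v; have [->|vNu] := eqVneq v u.
  by rewrite (rooted_root rf) (rooted_root rg).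
by have := eqfg (v, f v); rewrite !inE vNu eqxx => /esym/eqP.
Qed.

(** Outdegree 1 determines the parent of each vertex other than [u]; connectedness then forces every
    orbit to reach [u]. *)
Lemma oriented_spanning_treesE A u :
  oriented_spanning_trees A u = parent_arcs u @: parent_functions A u.
Proof.
apply/setP => T; apply/idP/imsetP; last first.
  case=> f; rewrite inE => /andP [rf /forallP fA] ->.
  rewrite inE is_tree_parent // !outdegree_parent eqxx /=.
  apply/andP; split; last first.
    by apply/forallP => v; apply/implyP => vNu; rewrite outdegree_parent vNu.
  apply/subsetP => -[x y]; rewrite inE /= => /andP [xNu /eqP <-].
  exact: implyP (fA x) xNu.
rewrite inE => /and4P [TA /andP [Tcon _] outu /forallP outv].
(* The default of [odflt] is never taken: off the root, the outdegree condition supplies an arc. *)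
pose f := [ffun v => if v == u then u else odflt v [pick w | (v, w) \in T]].
have fu : f u = u by rewrite ffunE eqxx.
have fT v w : v != u -> ((v, w) \in T) = (f v == w).
  move=> vNu; have := implyP (outv v) vNu.
  rewrite /outdegree => /cards1P [p /setP Tp].
  have Tv z : ((v, z) \in T) = ((v, z) == p).
    by have := Tp (v, z); rewrite !inE eqxx andbT.
  have p1 : p.1 = v by have := Tp p; rewrite !inE eqxx => /andP [_ /eqP].
  rewrite ffunE (negPf vNu); case: pickP => [z|] /=.
    by rewrite !Tv => /eqP <-; rewrite xpair_eqE eqxx eq_sym.
  by move/(_ p.2); rewrite Tv -p1 -surjective_pairing eqxx.
have TE : T = parent_arcs u f.
  apply/setP => -[x y]; rewrite inE /=; have [->|xNu] := eqVneq x u.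
    apply/negP => uyT; move: outu; rewrite cards_eq0 => /eqP/setP/(_ (u, y)).
    by rewrite !inE uyT eqxx.
  by rewrite fT.
have rf : rooted f u.
  rewrite /rooted fu eqxx; apply/forallP => v.
  (* The vertices that reach [u] are closed under adjacency and include [u], so by connectedness
     they are all of [V]. *)
  have clos : closed (underlying T) [pred x | fconnect f x u].
    apply: intro_closed; first exact/sym_connect_sym/underlying_sym.
    move=> x y; rewrite TE underlying_parent !inE => /orP [] /andP [zNu /eqP <-].
      move=> /iter_findex; case: (findex f x u) => [xu|k].
        by rewrite -xu eqxx in zNu.
      by rewrite iterSr => <-; apply: fconnect_iter.
    by apply: connect_trans; apply: fconnect1.
  have := closed_connect clos (forallP (forallP Tcon v) u).
  by rewrite !inE connect0.
exists f => //; rewrite inE rf; apply/forallP => v; apply/implyP => vNu.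
by apply: (subsetP TA); rewrite fT.
Qed.

(** * Undirected spanning trees as parent functions *)

Lemma acyclic_sub_connected R R' : symmetric R -> acyclic R ->
  subrel R' R -> connected R' -> forall x y, x != y -> R x y -> R' x y.
Proof.
move=> Rsym acR subR conR' x y xNy Rxy.
have /connectP [q qpath qlast] := forallP (forallP conR' x) y.
case/shortenP: qpath qlast => p ppath puniq _ plast.
have cyc : cycle R (x :: p).
  by rewrite /= rcons_path -plast Rsym Rxy (sub_path subR ppath).
have sz : (size (x :: p) < #|V|.+1)%N by rewrite ltnS -(card_uniqP puniq) max_card.
have := forallP (forallP acR (Ordinal sz)) (in_tuple (x :: p)).
(* Length 0 gives [x = y], length 1 is the claim, and a longer path closes up with the edge between
   [x] and [y] to a cycle of [R]. *)
case: p sz ppath plast cyc puniq => [|z [|w p]] /= sz ppath plast cyc puniq.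
- by rewrite plast eqxx in xNy.
- by move: ppath; rewrite andbT -plast.
- by case/negP; rewrite /ucycleb /= cyc.
Qed.

(* Breadth-first search: the parent is a neighbour closer to the root. *)
Lemma connected_rooted R u : connected R ->
  exists2 f, rooted f u & forall v, v != u -> R v (f v).
Proof.
move=> conR.
have ex v : exists k, [exists p : k.-tuple V, path R v p && (last v p == u)].
  have /connectP [p pp lp] := forallP (forallP conR v) u.
  by exists (size p); apply/existsP; exists (in_tuple p); rewrite pp -lp eqxx.
pose d v := ex_minn (ex v).
have closer v : v != u -> exists w, R v w && (d w < d v)%N.
  move=> vNu; rewrite {2}/d; case: ex_minnP => k /existsP [[p /= /eqP <-]].
  case: p => [vu|w p /= /andP [/andP [Rvw pp] /eqP lp] _].
    by rewrite /= (negPf vNu) in vu.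
  exists w; rewrite Rvw /d ltnS.
  case: ex_minnP => m _; apply; apply/existsP; exists (in_tuple p).
  by rewrite pp lp eqxx.
pose f := [ffun v => if v == u then u else odflt v [pick w | R v w && (d w < d v)%N]].
have fP v : v != u -> R v (f v) && (d (f v) < d v)%N.
  move=> vNu; rewrite ffunE (negPf vNu); case: pickP => //= none.
  by have [w] := closer v vNu; rewrite none.
exists f => [|v /fP /andP [] //].
rewrite /rooted ffunE !eqxx; apply/forallP => v.
have [n] := ubnP (d v); elim: n v => // n IHn v.
rewrite ltnS => dv; have [->|/fP /andP [_ dfv]] := eqVneq v u; first exact: connect0.
exact/(connect_trans (fconnect1 f v))/IHn/(leq_trans dfv).
Qed.

Lemma eq_set2 x y a b :
  ([set x; y] == [set a; b]) = (x == a) && (y == b) || (x == b) && (y == a).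
Proof.
apply/eqP/idP => [/setP E|]; last first.
  by case/orP => /andP [/eqP -> /eqP ->] //; rewrite setUC.
have := E x; have := E y; have := E a; have := E b; rewrite !inE !eqxx !orbT.
rewrite ![a == _]eq_sym ![b == _]eq_sym.
by case: (x == a); case: (x == b); case: (y == a); case: (y == b).
Qed.

Lemma edge_rel_sym (T : {set {set V}}) : symmetric (edge_rel T).
Proof. by move=> x y; rewrite /edge_rel /= setUC. Qed.

Lemma parent_edgesP u f (s : {set V}) :
  reflect (exists2 v, v != u & s = [set v; f v]) (s \in parent_edges u f).
Proof.
by apply: (iffP imsetP) => -[v vNu ->]; exists v; rewrite ?inE // in vNu *.
Qed.

Lemma edge_rel_parent u f :
  edge_rel (parent_edges u f) =2 underlying (parent_arcs u f).
Proof.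
move=> x y; rewrite underlying_parent /=; apply/parent_edgesP/orP.
  case=> v vNu /eqP; rewrite eq_set2.
  by case/orP => /andP [/eqP -> /eqP ->]; rewrite vNu eqxx; [left|right].
case=> /andP [zNu /eqP <-]; [by exists x|exists y => //].
by rewrite setUC.
Qed.

(** Depth drops at each step off the root. The case [f v = v] is included, so fixed points other
    than [u] are excluded too. *)
Lemma rooted_no_2cycle f u v : rooted f u -> v != u -> f (f v) != v.
Proof.
move=> rf vNu; have [d dP] := parent_depth rf; apply/eqP => ffv.
have [fvu|fvNu] := eqVneq (f v) u.
  by rewrite -ffv fvu (rooted_root rf) eqxx in vNu.
have := dP _ vNu; rewrite (dP _ fvNu) ffv => /eqP.
by rewrite -addn2 -{1}[d v]addn0 eqn_add2l.
Qed.

(* If f and g disagree at v, then {v, f v} must be the g-edge of f v, so they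
   also disagree at f v; hence they disagree all the way up to the root. *)
Lemma parent_edges_inj A u :
  {in parent_functions A u &, injective (parent_edges u)}.
Proof.
move=> f g; rewrite !inE => /andP [rf _] /andP [rg _] /setP eqfg.
apply/ffunP; apply: (rooted_ind rf) => [|v vNu eqfv].
  by rewrite (rooted_root rf) (rooted_root rg).
have : [set v; f v] \in parent_edges u g.
  by rewrite -eqfg; apply/parent_edgesP; exists v.
case/parent_edgesP => x xNu /eqP; rewrite eq_set2 => /orP [] /andP [/eqP vx /eqP fx].
  by rewrite fx vx.
have := rooted_no_2cycle rf vNu.
by rewrite eqfv fx -vx eqxx.
Qed.

(** Connectedness of [T] yields a parent function inside [T]; its edges already connect [V], so
    acyclicity of [T] leaves room for no further edge. *)
Lemma spanning_treesE e u : symmetric e -> irreflexive e ->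
  spanning_trees e = parent_edges u @: parent_functions (bidirected e) u.
Proof.
move=> e_sym e_irr; apply/setP => T; apply/idP/imsetP; last first.
  case=> f; rewrite inE => /andP [rf /forallP fA] ->.
  rewrite inE (eq_is_tree (edge_rel_parent u f)) is_tree_parent // andbT.
  apply/subsetP => s /parent_edgesP [v vNu ->]; apply/imsetP.
  by exists (v, f v) => //; have := implyP (fA v) vNu; rewrite !inE.
rewrite inE => /andP [/subsetP Te /andP [Tcon Tac]].
have TeP x y : edge_rel T x y -> e x y.
  move=> /Te /imsetP [[a b]]; rewrite inE /= => eab /eqP; rewrite eq_set2.
  by case/orP => /andP [/eqP -> /eqP ->]; rewrite // e_sym.
have [f rf fT] := connected_rooted u Tcon.
have sub : subrel (edge_rel (parent_edges u f)) (edge_rel T).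
  move=> x y; rewrite edge_rel_parent underlying_parent.
  case/orP => /andP [zNu /eqP <-]; first exact: fT.
  by rewrite edge_rel_sym; apply: fT.
have con : connected (edge_rel (parent_edges u f)).
  by have := is_tree_parent rf; rewrite -(eq_is_tree (edge_rel_parent u f)) => /andP [].
exists f.
  rewrite inE rf; apply/forallP => v; apply/implyP => vNu.
  by rewrite inE; apply/TeP/fT.
apply/setP => s; apply/idP/idP => [sT|/parent_edgesP [v vNu ->]]; last exact: fT.
have /imsetP [[x y]] := Te _ sT; rewrite inE /= => exy sE; rewrite sE in sT *.
apply: (acyclic_sub_connected (edge_rel_sym T) Tac sub con) => //.
by apply: contraTneq exy => ->; rewrite e_irr.
Qed.

(** Both families are injective images of the same set of parent functions. *)
Lemma card_spanning_trees e u : symmetric e -> irreflexive e ->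
  #|spanning_trees e| = kappa (bidirected e) u.
Proof.
move=> e_sym e_irr; rewrite /kappa oriented_spanning_treesE (spanning_treesE u) //.
rewrite (card_in_imset (@parent_edges_inj _ u)).
by rewrite (card_in_imset (@parent_arcs_inj _ u)).
Qed.

Lemma tree_weightE A (w : V -> V -> rat) u :
  tree_weight A w u = \sum_(f in parent_functions A u) \prod_(v | v != u) w v (f v).
Proof.
rewrite /tree_weight oriented_spanning_treesE.
rewrite (big_imset _ (@parent_arcs_inj A u)); apply: eq_bigr => f _ /=.
have -> : parent_arcs u f = [set (v, f v) | v in predC1 u].
  apply/setP => -[x y]; rewrite inE /=; apply/andP/imsetP.
    by case=> xNu /eqP <-; exists x.
  by case=> v vNu [-> ->].
by rewrite big_imset //= => x y _ _ [].
Qed.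

End ParentFunctions.

(** * Determinants under rank-one updates *)

Section RankOneUpdates.

Set Implicit Arguments.
Unset Strict Implicit.

Variable R : comNzRingType.

(** Sylvester's identity: the block matrix with rows [1, X] and [Y, 1] has two factorizations into
    block-triangular matrices. *)
Lemma det_1subXY m n (X : 'M[R]_(m, n)) (Y : 'M[R]_(n, m)) :
  \det (1%:M - X *m Y) = \det (1%:M - Y *m X).
Proof.
have E : block_mx (1%:M - X *m Y) X 0 1%:M *m block_mx 1%:M 0 Y 1%:M =
         block_mx 1%:M 0 Y 1%:M *m block_mx 1%:M X 0 (1%:M - Y *m X).
  rewrite !mulmx_block !mul1mx !mulmx1 !mul0mx !mulmx0 !add0r !addr0.
  by rewrite subrK addrC subrK.
have := congr1 determinant E.
by rewrite !det_mulmx !det_ublock !det_lblock !det1 !mul1r !mulr1.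
Qed.

Let one n : 'rV[R]_n := const_mx 1.

(* 1 + (a - c) 1^T carries L + c z to L + a z. *)
Lemma det_rank1_update n (L : 'M[R]_n) (a c : 'cV[R]_n) (z : 'rV[R]_n) :
  one n *m L = 0 -> one n *m c = 1%:M ->
  \det (L + a *m z) = \det (one n *m a) * \det (L + c *m z).
Proof.
move=> L0 c1.
have -> : L + a *m z = (1%:M - (c - a) *m one n) *m (L + c *m z).
  rewrite mulmxBl mul1mx mulmxDr -!mulmxA L0 mulmx0 add0r (mulmxA (one n)) c1.
  by rewrite mul1mx mulmxBl opprB -addrA [X in _ = _ + X]addrC subrK.
by rewrite det_mulmx det_1subXY mulmxBr c1 opprB addrCA subrr addr0.
Qed.

(** The column factor is replaced first; after transposition, the zero row sums of [L] allow the row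
    factor to be replaced in the same way. *)
Lemma det_rank1_zero_sums n (L : 'M[R]_n) (a c : 'cV[R]_n) (z y : 'rV[R]_n) :
  one n *m L = 0 -> L *m (one n)^T = 0 ->
  one n *m c = 1%:M -> y *m (one n)^T = 1%:M ->
  \det (L + a *m z) = \det (one n *m a) * \det (z *m (one n)^T) * \det (L + c *m y).
Proof.
move=> L0 L0' c1 y1; rewrite (det_rank1_update a z L0 c1) -mulrA; congr (_ * _).
rewrite -(det_tr (L + _)) linearD /= trmx_mul (@det_rank1_update _ L^T _ y^T).
- rewrite -(det_tr (one n *m _)) trmx_mul trmxK; congr (_ * _).
  by rewrite -trmx_mul -linearD det_tr.
- by rewrite -[one n]trmxK -trmx_mul L0' trmx0.
- by rewrite -[one n]trmxK -trmx_mul y1 trmx1.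
Qed.

End RankOneUpdates.

(** * The matrix-tree theorem for weighted digraphs *)

Section MatrixTree.

Set Implicit Arguments.
Unset Strict Implicit.

Definition laplacian {n} (w : 'I_n -> 'I_n -> rat) : 'M[rat]_n :=
  \matrix_(i, j) ((i == j)%:R * \sum_k w i k - w i j).

(** Its determinant is the Laplacian minor without row and column [k], but the size stays [n]. *)
Definition rooted_laplacian {n} (w : 'I_n -> 'I_n -> rat) (k : 'I_n) : 'M[rat]_n :=
  \matrix_(i, j) if i == k then (i == j)%:R else laplacian w i j.

(** The enumeration is a parameter so that the theorem applies to the vertices through [enum_val]
    and to ['I_r] through the identity. *)
Variables (V : finType) (n : nat) (b : 'I_n -> V) (b' : V -> 'I_n).
Hypotheses (bK : cancel b b') (b'K : cancel b' b).

Lemma reindex_enumeration (S : Type) (idx : S) (op : Monoid.com_law idx) (F : V -> S) :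
  \big[op/idx]_i F (b i) = \big[op/idx]_v F v.
Proof. by symmetry; apply: reindex; apply: onW_bij; exists b'. Qed.

(** Off the root this is the Laplacian of the functional graph of [f]; the root row is the unit
    vector at [u]. *)
Let step_mx u (f : V -> V) : 'M[rat]_n :=
  \matrix_(i, j) ((b i == b j)%:R - (b i != u)%:R * (f (b i) == b j)%:R).

Lemma det_step_mx_rooted u (f : {ffun V -> V}) : rooted f u -> \det (step_mx u f) = 1.
Proof.
move=> rf; rewrite /determinant (bigD1 (1%g : 'S_n)) //= odd_perm1 expr0 mul1r.
rewrite big1 => [|i _]; last first.
  rewrite perm1 mxE eqxx; have [_|biNu] := eqVneq (b i) u; first by rewrite mul0r subr0.
  (* The diagonal entry is 1 because [f] fixes no vertex other than [u]. *)
  have := rooted_no_2cycle rf biNu.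
  by have [fbi|] := eqVneq (f (b i)) (b i); rewrite ?fbi ?eqxx // mulr0 subr0.
rewrite big1 ?addr0 // => s; apply: contraNeq => prod_n0.
(* A nonzero term has s = f off the fixed points of s and off the root; such
   an s is the identity, by going down from the root. *)
have step i : s i != i -> b i != u /\ f (b i) = b (s i).
  move=> siNi; have nz : step_mx u f i (s i) != 0.
    by apply: contraNneq prod_n0 => nz; rewrite (bigD1 i) //= nz mul0r mulr0.
  move: nz; rewrite mxE (inj_eq (can_inj bK)) [i == _]eq_sym (negPf siNi) sub0r oppr_eq0.
  have [_|_] := eqVneq (b i) u; first by rewrite mul0r eqxx.
  by have [-> //|_] := eqVneq (f (b i)) (b (s i)); rewrite mulr0 eqxx.
apply/eqP/permP => i; rewrite perm1 -(bK i); move: (b i).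
apply: (rooted_ind rf) => [|v vNu fixfv]; apply/eqP/negPn/negP => /step; rewrite b'K.
  by rewrite eqxx => -[].
case=> _ fv; move: fixfv; rewrite fv bK => /perm_inj sv.
by have := rooted_no_2cycle rf vNu; rewrite fv sv b'K fv sv b'K eqxx.
Qed.

Lemma det_step_mx_unrooted u (f : {ffun V -> V}) :
  f u = u -> ~~ rooted f u -> \det (step_mx u f) = 0.
Proof.
move=> fu; rewrite /rooted fu eqxx /= negb_forall => /existsP [v vu].
(* The indicator of the vertices that do not reach the root is in the kernel. *)
pose chi w : rat := (~~ fconnect f w u)%:R.
have chi_f w : w != u -> chi (f w) = chi w.
  move=> wNu; congr (~~ _)%:R; apply/idP/idP => [|/iter_findex].
    exact/connect_trans/fconnect1.
  case: (findex f w u) => [wu|k]; first by rewrite -wu eqxx in wNu.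
  by rewrite iterSr => <-; apply: fconnect_iter.
(* [det0P] asks for a left kernel vector, whereas the indicator is a right one; hence the
   transpose. *)
rewrite -det_tr; apply/eqP/det0P; exists (\row_j chi (b j)).
  apply/eqP => /rowP /(_ (b' v)); rewrite !mxE b'K /chi vu => /eqP.
  by rewrite oner_eq0.
apply/rowP => i; rewrite !mxE.
transitivity (\sum_x chi x * ((b i == x)%:R - (b i != u)%:R * (f (b i) == x)%:R)).
  by rewrite -reindex_enumeration; apply: eq_bigr => j _; rewrite !mxE.
under eq_bigr => x _ do rewrite mulrBr.
rewrite sumrB.
have pick y (c : rat) : \sum_x chi x * (c * (y == x)%:R) = c * chi y.
  rewrite (bigD1 y) //= eqxx mulr1 mulrC big1 ?addr0 // => x xNy.
  by rewrite eq_sym (negPf xNy) !mulr0.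
under eq_bigr => x _ do rewrite -[(_ == _)%:R]mul1r.
rewrite !pick mul1r; have [->|biNu] := eqVneq (b i) u.
  by rewrite mul0r subr0 /chi connect0.
by rewrite mul1r chi_f // subrr.
Qed.

(* Row i of the Laplacian is the sum over k of w i k times the row
   delta_i - delta_k; expanding every row, the determinant becomes a sum over
   all functions, and only the parent functions contribute. *)
Lemma matrix_tree (A : {set V * V}) (w : V -> V -> rat) u :
  (forall x y, (x, y) \notin A -> w x y = 0) ->
  \det (rooted_laplacian (fun i j => w (b i) (b j)) (b' u)) = tree_weight A w u.
Proof.
(* At the root, [W] is concentrated at [u]: this gives the unit row and kills every function that
   moves [u]. *)
move=> wA; pose W x z := if x == u then (z == u)%:R else w x z.
pose N x z y : rat := (x == y)%:R - (x != u)%:R * (z == y)%:R.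
have KE i j : rooted_laplacian (fun i j => w (b i) (b j)) (b' u) i j =
              \sum_z W (b i) z * N (b i) z (b j).
  rewrite !mxE /W /N -!(inj_eq (can_inj bK)) b'K; have [->|biNu] := eqVneq (b i) u.
    rewrite (bigD1 u) //= eqxx mul1r mul0r subr0 big1 ?addr0 //.
    by move=> z /negPf ->; rewrite mul0r.
  under [RHS]eq_bigr => z _ do rewrite mulrBr mul1r.
  rewrite sumrB -mulr_suml mulrC reindex_enumeration; congr (_ - _).
  by rewrite (bigD1 (b j)) //= eqxx mulr1 big1 ?addr0 // => z /negPf ->; rewrite mulr0.
transitivity (\sum_(f : {ffun V -> V}) (\prod_x W x (f x)) * \det (step_mx u f)).
  rewrite /determinant.
  transitivity (\sum_(s : 'S_n) \sum_(f : {ffun V -> V})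
      (-1) ^+ s * \prod_x (W x (f x) * N x (f x) (b (s (b' x))))).
    apply: eq_bigr => s _; rewrite -mulr_sumr; congr (_ * _).
    (* A product of row sums is a sum over the functions choosing one summand in each row. *)
    rewrite -(bigA_distr_bigA (fun x z => W x z * N x z (b (s (b' x))))).
    rewrite -reindex_enumeration; apply: eq_bigr => i _.
    by rewrite KE bK.
  rewrite exchange_big /=; apply: eq_bigr => f _; rewrite mulr_sumr.
  apply: eq_bigr => s _; rewrite big_split /= mulrCA; congr (_ * (_ * _)).
  by rewrite -reindex_enumeration; apply: eq_bigr => i _; rewrite mxE bK.
rewrite tree_weightE [RHS]big_mkcond /=; apply: eq_bigr => f _.
rewrite (bigD1 u) //= {1}/W eqxx.
have -> : \prod_(x | x != u) W x (f x) = \prod_(x | x != u) w x (f x).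
  by apply: eq_bigr => x /negPf xNu; rewrite /W xNu.
rewrite inE; have [fu|fuNu] := eqVneq (f u) u; last first.
  by rewrite /rooted (negPf fuNu) /= !mul0r.
rewrite mul1r; have [rf|nrf] /= := boolP (rooted f u); last first.
  by rewrite det_step_mx_unrooted ?mulr0.
(* A rooted function using a pair outside [A] has weight 0. *)
rewrite det_step_mx_rooted // mulr1; case: ifPn => // /forallPn [v].
rewrite negb_imply => /andP [vNu /wA w0].
by rewrite (bigD1 v) //= w0 mul0r.
Qed.

End MatrixTree.

(** * Biclique partitions and weights of the biclique digraph *)

Section Bicliques.

Set Implicit Arguments.
Unset Strict Implicit.

Variables (V : finType) (e : rel V) (r : nat) (Q : 'I_r -> {set V} * {set V}).
Hypotheses (e_sym : symmetric e) (e_irr : irreflexive e) (e_conn : connected e).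
Hypothesis Q_part : biclique_partition (bidirected e) Q.

Let tailQ x j : rat := (x \in (Q j).1)%:R.
Let headQ j x : rat := (x \in (Q j).2)%:R.
Let wQ : 'I_r -> 'I_r -> rat := Theta_weight e Q.

Lemma sum_mem (A : {set V}) : \sum_x (x \in A)%:R = #|A|%:R :> rat.
Proof.
rewrite -sum1_card natr_sum [RHS]big_mkcond.
by apply: eq_bigr => x _; case: (_ \in _).
Qed.

(** The adjacency matrix factors as tail incidence times head incidence because each arc lies in
    exactly one biclique. *)
Lemma biclique_partition_sum x y :
  \sum_j tailQ x j * headQ j y = (e x y)%:R.
Proof.
have [Q_in Q_uniq] := Q_part.
have term j : tailQ x j * headQ j y = ((x, y) \in biclique_arcs (Q j))%:R.
  by rewrite /biclique_arcs in_setX /tailQ /headQ; do 2!case: (_ \in _); rewrite ?mulr0 ?mulr1.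
have [exy|/negPf nexy] := boolP (e x y).
  have [|i [i_in i_uniq]] := Q_uniq (x, y); first by rewrite inE.
  rewrite (bigD1 i) //= term i_in big1 ?addr0 // => j jNi; rewrite term.
  by case: (boolP (_ \in _)) => // /i_uniq ij; rewrite ij eqxx in jNi.
rewrite big1 // => j _; rewrite term; case: (boolP (_ \in _)) => // xyj.
have /and4P [_ _ _ /subsetP /(_ _ xyj)] := Q_in j.
by rewrite inE /= nexy.
Qed.

Lemma sum_headQ j : \sum_y headQ j y = #|(Q j).2|%:R.
Proof. exact: sum_mem. Qed.

Lemma degree_sum x : (degree e x)%:R = \sum_y (e x y)%:R :> rat.
Proof.
rewrite /degree -sum1_card natr_sum big_mkcond /=.
by apply: eq_bigr => y _; rewrite inE; case: (e x y).
Qed.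

(** The arcs leaving [x] are counted biclique by biclique. *)
Lemma degree_tailQ x : \sum_j tailQ x j * #|(Q j).2|%:R = (degree e x)%:R.
Proof.
rewrite degree_sum; under [RHS]eq_bigr => y _ do rewrite -biclique_partition_sum.
by rewrite exchange_big; apply: eq_bigr => j _; rewrite -mulr_sumr sum_headQ.
Qed.

(** An arc of [Q i] guarantees a second vertex, so connectedness gives [v] a neighbour. A one-vertex
    graph has degree 0, hence the index [i]. *)
Lemma degree_neq0 (i : 'I_r) v : (degree e v)%:R != 0 :> rat.
Proof.
have [Q_in _] := Q_part; have /and4P [/set0Pn [x xi] /set0Pn [y yi] _ /subsetP] := Q_in i.
move=> /(_ (x, y)); rewrite in_setX xi yi inE /= => /(_ isT) exy.
have [w vw] : exists w, v != w.
  have [->|vx] := eqVneq v x; last by exists x.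
  by exists y; apply: contraTneq exy => ->; rewrite e_irr.
have /connectP [[|z p] /= vz lp] := forallP (forallP e_conn v) w.
  by rewrite lp eqxx in vw.
rewrite pnatr_eq0 cards_eq0; apply/set0Pn; exists z; rewrite inE.
by case/andP: vz.
Qed.

(** This exhibits the weight as an entry of [C D^-1 B q]. *)
Lemma wQE i j :
  wQ i j = \sum_x headQ i x * ((degree e x)%:R^-1 * (tailQ x j * #|(Q j).2|%:R)).
Proof.
rewrite /wQ /Theta_weight mulr_sumr big_mkcond /=; apply: eq_bigr => x _.
rewrite inE /headQ /tailQ; do 2!case: (_ \in _); rewrite ?mul1r ?mul0r ?mulr0 //.
by rewrite mulrC.
Qed.

(** Identifies the diagonal part of the Laplacian of Theta with [q]. *)
Lemma sum_wQ i : \sum_j wQ i j = #|(Q i).2|%:R.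
Proof.
under eq_bigr => j _ do rewrite wQE.
rewrite exchange_big -sum_headQ; apply: eq_bigr => x _ /=.
by rewrite -!mulr_sumr degree_tailQ mulVf ?mulr1 // (degree_neq0 i).
Qed.

Lemma Theta_weight_out i j : (i, j) \notin Theta_arcs Q -> wQ i j = 0.
Proof. by rewrite inE negbK /wQ /Theta_weight => /eqP ->; rewrite big_set0 mulr0. Qed.

(** * The two determinant evaluations and their comparison *)

Let n := #|V|.
Let b : 'I_n -> V := enum_val.
Let b' : V -> 'I_n := enum_rank.

Let bK : cancel b b'. Proof. exact: enum_valK. Qed.
Let b'K : cancel b' b. Proof. exact: enum_rankK. Qed.

Let B : 'M[rat]_(n, r) := \matrix_(v, j) tailQ (b v) j.
Let C : 'M[rat]_(r, n) := \matrix_(j, v) headQ j (b v).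
Let deg : 'rV[rat]_n := \row_v (degree e (b v))%:R.
Let degV : 'rV[rat]_n := \row_v (degree e (b v))%:R^-1.
Let sizes : 'rV[rat]_r := \row_j #|(Q j).2|%:R.
Let adj : 'I_n -> 'I_n -> rat := fun v w => (e (b v) (b w))%:R.

Lemma laplacian_biclique : laplacian adj = diag_mx deg - B *m C.
Proof.
apply/matrixP => v w; rewrite !mxE mulr_natl degree_sum; congr (_ *+ _ - _).
  by rewrite /adj (reindex_enumeration bK b'K _ (fun y => (e (b v) y)%:R)).
by rewrite /adj -biclique_partition_sum; apply: eq_bigr => j _; rewrite !mxE.
Qed.

Lemma tree_weight_bidirected u :
  tree_weight (bidirected e) (fun x y => (e x y)%:R) u = (kappa (bidirected e) u)%:R.
Proof.
rewrite /tree_weight /kappa -sum1_card natr_sum; apply: eq_bigr => T.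
rewrite inE => /and4P [/subsetP Te _ _ _]; apply: big1 => p /Te.
by rewrite inE => ->.
Qed.

Lemma det_laplacian_without_biclique u (i : 'I_r) :
  \det (diag_mx deg - B *m (1%:M - delta_mx i i) *m C) =
  #|(Q i).1|%:R * #|(Q i).2|%:R * (kappa (bidirected e) u)%:R.
Proof.
pose one : 'rV[rat]_n := const_mx 1.
pose c : 'cV[rat]_n := delta_mx (b' u) 0.
(* Adding [c *m y] to the Laplacian overwrites row [b' u] by the unit row; as the old row sums to 0,
   the entries of [y] sum to 1. *)
pose y : 'rV[rat]_n := delta_mx 0 (b' u) - row (b' u) (laplacian adj).
have sumr : laplacian adj *m one^T = 0.
  apply/matrixP => v j; rewrite !mxE.
  under eq_bigr => w _ do rewrite !mxE mulr1.
  rewrite sumrB -mulr_suml (bigD1 v) //= eqxx big1 ?addr0 ?mul1r ?subrr //.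
  by move=> w /negPf wNv; rewrite eq_sym wNv.
(* Symmetry of [e] turns zero row sums into zero column sums. *)
have lapT : (laplacian adj)^T = laplacian adj.
  apply/matrixP => v w; rewrite !mxE /adj e_sym eq_sym.
  by have [->|] := eqVneq v w; rewrite ?mul0r.
have suml : one *m laplacian adj = 0.
  by apply: trmx_inj; rewrite trmx_mul lapT sumr trmx0.
have oneE m (a : 'M[rat]_(n, m)) j : (one *m a) 0 j = \sum_v a v j.
  by rewrite !mxE; apply: eq_bigr => v _; rewrite mxE mul1r.
have c1 : one *m c = 1%:M.
  apply/matrixP => k j; rewrite !ord1 oneE (bigD1 (b' u)) //= !mxE !eqxx big1 ?addr0 //.
  by move=> v /negPf vNu; rewrite mxE vNu.
have y1 : y *m one^T = 1%:M.
  by rewrite mulmxBl -row_mul sumr row0 subr0 -(trmxK (delta_mx _ _)) -trmx_mul trmx_delta c1 trmx1.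
have -> : diag_mx deg - B *m (1%:M - delta_mx i i) *m C =
          laplacian adj + col i B *m row i C.
  rewrite laplacian_biclique mulmxBr mulmxBl mulmx1 opprB addrCA addrC; congr (_ + _).
  by rewrite colE rowE !mulmxA -(mulmxA B) mul_delta_mx.
rewrite (det_rank1_zero_sums (col i B) (row i C) suml sumr c1 y1).
have -> : laplacian adj + c *m y = rooted_laplacian adj (b' u).
  apply/matrixP => v w; rewrite mulmxBr mul_delta_mx !mxE big_ord1 !mxE.
  rewrite eqxx andbT; have [->|vNu] := eqVneq v (b' u).
    by rewrite mul1r addrCA subrr addr0 eq_sym.
  by rewrite mul0r subrr addr0.
have -> : \det (rooted_laplacian adj (b' u)) = (kappa (bidirected e) u)%:R.
  rewrite -tree_weight_bidirected; apply: (matrix_tree bK b'K) => x z.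
  by rewrite inE /= => /negPf ->.
congr (_ * _ * _).
  rewrite det_mx11 oneE; under eq_bigr => v _ do rewrite !mxE.
  by rewrite (reindex_enumeration bK b'K _ (tailQ^~ i)) sum_mem.
rewrite -det_tr trmx_mul trmxK det_mx11 oneE; under eq_bigr => v _ do rewrite !mxE.
by rewrite (reindex_enumeration bK b'K _ (headQ i)) sum_headQ.
Qed.

Lemma det_Theta_rooted (i : 'I_r) :
  \det (1%:M - (1%:M - delta_mx i i) *m C *m (diag_mx degV *m B)) *
    \prod_j #|(Q j).2|%:R =
  #|(Q i).2|%:R * tree_weight (Theta_arcs Q) wQ i.
Proof.
have -> : \prod_j #|(Q j).2|%:R = \det (diag_mx sizes).
  by rewrite det_diag; apply: eq_bigr => j _; rewrite mxE.
rewrite -det_mulmx -(@matrix_tree _ _ id id _ _ (Theta_arcs Q)) //; last exact: Theta_weight_out.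
have CDBE k j : (C *m (diag_mx degV *m B) *m diag_mx sizes) k j = wQ k j.
  rewrite mul_mx_diag 2!mxE wQE -(reindex_enumeration bK b'K) mulr_suml.
  by apply: eq_bigr => v _; rewrite mul_diag_mx !mxE -!mulrA.
have M_diag : 1%:M - delta_mx i i = diag_mx (\row_k (k != i)%:R) :> 'M[rat]_r.
  apply/matrixP => k j; rewrite !mxE; have [->|kNj] := eqVneq k j.
    by case: (j == i); rewrite /= ?subrr ?subr0.
  by have [ki|] := eqVneq k i; rewrite ?subrr // -ki eq_sym (negPf kNj) subrr.
have entry k j :
    ((1%:M - (1%:M - delta_mx i i) *m C *m (diag_mx degV *m B)) *m diag_mx sizes) k j
    = (k == j)%:R * #|(Q k).2|%:R - (k != i)%:R * wQ k j.
  rewrite mulmxBl mul1mx M_diag -[_ *m C *m _]mulmxA -[_ *m _ *m diag_mx sizes]mulmxA.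
  rewrite mul_diag_mx mxE; congr (_ + _).
    by rewrite !mxE mulr_natl; have [->|] := eqVneq k j.
  by rewrite 2!mxE CDBE mxE.
(* Multilinearity in row [i], with second coefficient 0, extracts the factor [#|(Q i).2|]; the other
   rows agree by [sum_wQ]. *)
rewrite (determinant_multilinear (i0 := i) (b := #|(Q i).2|%:R) (c := 0)
  (B := rooted_laplacian wQ i) (C := rooted_laplacian wQ i)) ?mul0r ?addr0 //.
- by apply/rowP => j; rewrite [LHS]mxE entry !mxE eqxx mul0r subr0 mul0r addr0 mulrC.
- apply/matrixP => k j; rewrite [RHS]mxE entry [lift i k == i]eq_sym (negPf (neq_lift i k)).
  by rewrite !mxE [lift i k == i]eq_sym (negPf (neq_lift i k)) mul1r sum_wQ.
- apply/matrixP => k j; rewrite [RHS]mxE entry [lift i k == i]eq_sym (negPf (neq_lift i k)).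
  by rewrite !mxE [lift i k == i]eq_sym (negPf (neq_lift i k)) mul1r sum_wQ.
Qed.

Lemma biclique_tree_formula u (i : 'I_r) :
  (kappa (bidirected e) u)%:R =
    (\prod_(v : V) (degree e v)%:R) / (\prod_(j < r) #|(Q j).2|%:R)
    * (tree_weight (Theta_arcs Q) wQ i / #|(Q i).1|%:R) :> rat.
Proof.
have [Q_in _] := Q_part.
have tail0 j : #|(Q j).1|%:R != 0 :> rat.
  by rewrite pnatr_eq0 cards_eq0; case/and4P: (Q_in j).
have head0 j : #|(Q j).2|%:R != 0 :> rat.
  by rewrite pnatr_eq0 cards_eq0; case/and4P: (Q_in j).
have sizes0 : \prod_(j < r) #|(Q j).2|%:R != 0 :> rat by apply/prodf_neq0.
pose M : 'M[rat]_r := 1%:M - delta_mx i i.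
have degK : diag_mx deg *m diag_mx degV = 1%:M.
  apply/matrixP => v w; rewrite mul_diag_mx !mxE mulrnAr divff //.
  exact: degree_neq0 i _.
have factor : diag_mx deg - B *m M *m C =
    diag_mx deg *m (1%:M - (diag_mx degV *m B) *m (M *m C)).
  by rewrite [RHS]mulmxBr mulmx1 !mulmxA degK mul1mx.
have := det_laplacian_without_biclique u i.
(* Swapping the factors passes from a determinant over vertices to one over bicliques. *)
rewrite factor det_mulmx det_1subXY det_diag.
under eq_bigr => v _ do rewrite mxE.
rewrite (reindex_enumeration bK b'K _ (fun v => (degree e v)%:R)).
have := det_Theta_rooted i; rewrite -/M.
set X := \det _; set P := \prod_j _; set D := \prod_v _; set t := tree_weight _ _ _.
move=> XP DX; rewrite mulf_div; apply: (canRL (mulfK (mulf_neq0 sizes0 (tail0 i)))).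
(* Both evaluations carry the factor [#|(Q i).2|], so the equality is compared after multiplying by
   it. *)
apply: (mulfI (head0 i)); rewrite [RHS]mulrCA -XP [RHS]mulrA DX.
by rewrite [P * _]mulrC !mulrA; congr (_ * _); rewrite mulrC mulrA.
Qed.

End Bicliques.

Theorem mainTheorem5 (V : finType) (e : rel V)
  (e_sym : symmetric e) (e_irr : irreflexive e) (e_conn : connected e)
  (r : nat) (Q : 'I_r -> {set V} * {set V})
  (Q_part : biclique_partition (bidirected e) Q) (u : V) :
  #|spanning_trees e| = kappa (bidirected e) u /\
  (forall i : 'I_r,
     (kappa (bidirected e) u)%:R =
       (\prod_(v : V) (degree e v)%:R) / (\prod_(j < r) #|(Q j).2|%:R)
       * (tree_weight (Theta_arcs Q) (Theta_weight e Q) i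
          / #|(Q i).1|%:R) :> rat).
Proof.
split; first exact: card_spanning_trees.
by move=> i; apply: biclique_tree_formula.
Qed.
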